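(* The Baernstein spaces $B_p$, for $1<p<\infty$, and the Schreier spaces $S_p$, for $1\le p<\infty$, contain block basic sequences (of the unit vector basis) whose closed span is not complemented. More precisely, let $(E,D)=(B_p,\ell_p)$ for some $1<p<\infty$ or $(E,D)=(S_p,c_0)$ for some $1\le p<\infty$, and let $(u_n)_{n\in\mathbb{N}}$ be a skipped, normalized block basic sequence of the unit vector basis $(e_n)_{n\in\mathbb{N}}$ for $E$ such that the unit vector basis for $D$ dominates $(u_n)_{n\in\mathbb{N}}$. For each $n\in\mathbb{N}$, take $m_n\in(\max\operatorname{supp}u_n,\min\operatorname{supp}u_{n+1})\cap\mathbb{N}$ and set $$t_n=\frac1k\qquad(n\in[2^{k-1},2^k)\cap\mathbb{N},\ k\in\mathbb{N}).$$ Then $(u_n+t_ne_{m_n})_{n\in\mathbb{N}}$ is a block basic sequence whose closed span is not complemented in $E$.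
   Context: $\mathbb{K}$ denotes the scalar field, either $\mathbb{R}$ or $\mathbb{C}$, and $\mathbb{N}=\{1,2,3,\ldots\}$. Sequences are written as functions: $x(n)$ is the $n$-th coordinate of $x\in\mathbb{K}^{\mathbb{N}}$, and $\operatorname{supp}x=\{n\in\mathbb{N}:x(n)\ne0\}$. The unit vector basis $(e_n)_{n\in\mathbb{N}}$ is given by $e_n(m)=1$ if $m=n$ and $e_n(m)=0$ otherwise. A Schreier set is a finite set $F\subset\mathbb{N}$ such that $F=\emptyset$ or $|F|\le\min F$; $\mathcal{S}_1$ denotes the family of all Schreier sets. For non-empty finite sets $F,G\subset\mathbb{N}$, $F<G$ means $\max F<\min G$. $p$-convexified Schreier space $S_p$ ($1\le p<\infty$): for $x\in\mathbb{K}^{\mathbb{N}}$ and $F\in\mathcal{S}_1$ set $\mu_p(x,F)=\bigl(\sum_{n\in F}|x(n)|^p\bigr)^{1/p}$ (equal to $0$ if $F=\emptyset$) and $\|x\|_{S_p}=\sup\{\mu_p(x,F):F\in\mathcal{S}_1\}$. Let $Z_p=\{x\in\mathbb{K}^{\mathbb{N}}:\|x\|_{S_p}<\infty\}$, a Banach space under $\|\cdot\|_{S_p}$; $S_p$ is the closed linear span of $\{e_n:n\in\mathbb{N}\}$ in $Z_p$. Baernstein space $B_p$ ($1<p<\infty$): a Schreier chain is a non-empty finite collection $\mathcal{C}=\{F_1<F_2<\cdots<F_m\}$ of non-empty Schreier sets. Set $\beta_p(x,\mathcal{C})=\bigl(\sum_{F\in\mathcal{C}}\bigl(\sum_{n\in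 F}|x(n)|\bigr)^p\bigr)^{1/p}$ and $\|x\|_{B_p}=\sup\{\beta_p(x,\mathcal{C}):\mathcal{C}\text{ a Schreier chain}\}$. Then $B_p=\{x\in\mathbb{K}^{\mathbb{N}}:\|x\|_{B_p}<\infty\}$, a Banach space under $\|\cdot\|_{B_p}$. The unit vector basis is a normalized basis for $E$. A block basic sequence of it is a sequence of non-zero finitely supported vectors $(u_n)$ with $\max\operatorname{supp}u_n<\min\operatorname{supp}u_{n+1}$ for all $n$; it is normalized if $\|u_n\|_E=1$ for all $n$. A block basic sequence $(u_n)$ of a basis $(x_n)$ is skipped if there are integers $0=m_0<m_1<m_2<\cdots$ such that $u_n\in\operatorname{span}\{x_j:m_{n-1}<j<m_n\}$ for every $n\in\mathbb{N}$. A basic sequence $(x_n)$ dominates a basic sequence $(y_n)$ (possibly in another Banach space) if there is $C>0$ such that $\|\sum_{n=1}^k\alpha_ny_n\|\le C\|\sum_{n=1}^k\alpha_nx_n\|$ for all $k\in\mathbb{N}$ and $\alpha_1,\ldots,\alpha_k\in\mathbb{K}$. A closed subspace is complemented in $E$ if it is the range of a bounded linear projection on $E$. *)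

(* Defs.v *)
(* Index convention.  MathComp's [nat] starts at 0 whereas the sequences here
   are indexed by {1, 2, 3, ...}.  Everything is shifted by one: the index
   [i : nat] stands for the positive integer [i.+1], both for the coordinates
   of a vector and for the terms of a sequence of vectors.  Order conditions
   between indices are unaffected; whenever the actual value of an index
   matters, it appears as [i.+1]. *)
From HB Require Import structures.
From mathcomp Require Import all_boot all_order all_algebra finmap.
From mathcomp Require Import complex.
From mathcomp Require Import all_classical all_reals all_analysis.

Set Implicit Arguments.
Unset Strict Implicit.
Unset Printing Implicit Defensive.

Import Order.TTheory GRing.Theory Num.Theory.
Import numFieldNormedType.Exports.

Local Open Scope classical_set_scope.
Local Open Scope ring_scope.

Variant scalar_kind := RealScalars | ComplexScalars.

Definition scalars (R : realType) (k : scalar_kind) : numFieldType :=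
  match k with
  | RealScalars => R
  | ComplexScalars => R[i]%C
  end.

(* The absolute value with values in [R]; on [R[i]] MathComp's own [`|z|]
   takes its values in [R[i]]. *)
Definition modulus (R : realType) (k : scalar_kind) : scalars R k -> R :=
  match k with
  | RealScalars => fun x : R => `|x|
  | ComplexScalars => fun z : R[i]%C => ComplexField.Normc.normc z
  end.

Arguments modulus {R k}.

Notation vec R k := (nat -> (scalars R k)^o).

Section SequenceSpaces.
Context {R : realType} {k : scalar_kind}.
Local Notation K := (scalars R k).
Local Notation vec := (vec R k).

Definition supp (x : vec) : set nat := [set n | x n != 0].

Definition unit_vec (n : nat) : vec := fun j => (j == n)%:R.

(* A normed space of scalar sequences.  [ss_norm] is defined on all sequences,
   with value in [0, +oo]. *)
Record seq_space := SeqSpace {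
  ss_carrier : set vec;
  ss_norm : vec -> \bar R
}.

Definition finite_norm_space (N : vec -> \bar R) : seq_space :=
  SeqSpace [set x | (N x < +oo)%E] N.

Definition lin_span (A : set vec) : set vec :=
  [set x | exists (n : nat) (a : 'I_n -> K) (y : 'I_n -> vec),
     (forall i, A (y i)) /\ x = \sum_(i < n) a i *: y i].

Definition closed_span (E : seq_space) (A : set vec) : set vec :=
  [set x | ss_carrier E x /\
     forall eps : R, 0 < eps ->
       exists2 y, lin_span A y & (ss_norm E (x - y)%R < eps%:E)%E].

Definition complemented (E : seq_space) (Y : set vec) : Prop :=
  exists P : vec -> vec,
    [/\ (forall x, ss_carrier E x -> ss_carrier E (P x)),
        (forall (a : K) (x y : vec), ss_carrier E x -> ss_carrier E y ->
           P (a *: x + y) = a *: P x + P y),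
        (exists C : R, forall x, ss_carrier E x ->
           (ss_norm E (P x) <= C%:E * ss_norm E x)%E),
        (forall x, ss_carrier E x -> P (P x) = P x) &
        P @` ss_carrier E = Y].

Definition set_lt (A B : set nat) : Prop :=
  forall i j, A i -> B j -> (i < j)%N.

Definition block_basic (u : nat -> vec) : Prop :=
  [/\ (forall n, u n <> 0),
      (forall n, finite_set (supp (u n))) &
      (forall n, set_lt (supp (u n)) (supp (u n.+1)))].

Definition normalized (E : seq_space) (u : nat -> vec) : Prop :=
  forall n, ss_norm E (u n) = 1%E.

(* [q] is the sequence of integers 0 = q 0 < q 1 < ... and is not shifted. *)
Definition skipped (x u : nat -> vec) : Prop :=
  exists q : nat -> nat,
    [/\ q 0 = 0, (forall n, (q n < q n.+1)%N) &
        forall n, lin_span (x @` [set j | (q n < j.+1 < q n.+1)%N]) (u n)].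

Definition dominates (E : seq_space) (x : nat -> vec)
    (F : seq_space) (y : nat -> vec) : Prop :=
  exists2 C : R, 0 < C &
    forall (n : nat) (a : nat -> K),
      (ss_norm F (\sum_(i < n) a i *: y i)%R
         <= C%:E * ss_norm E (\sum_(i < n) a i *: x i)%R)%E.

(* |F| <= min F; vacuous for the empty set. *)
Definition schreier_set (F : {fset nat}) : Prop :=
  forall i, i \in F -> (#|` F| <= i.+1)%N.

Definition schreier_chain (C : seq {fset nat}) : Prop :=
  [/\ C <> [::],
      (forall F, F \in C -> F <> fset0 /\ schreier_set F) &
      sorted (fun F G : {fset nat} => allrel ltn F G) C].

Definition schreier_mu (p : R) (x : vec) (F : {fset nat}) : R :=
  (\sum_(n <- F) modulus (x n) `^ p) `^ p^-1.

Definition schreier_norm (p : R) (x : vec) : \bar R :=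
  ereal_sup [set (schreier_mu p x F)%:E | F in schreier_set].

Definition baernstein_beta (p : R) (x : vec) (C : seq {fset nat}) : R :=
  (\sum_(F <- C) (\sum_(n <- F) modulus (x n)) `^ p) `^ p^-1.

Definition baernstein_norm (p : R) (x : vec) : \bar R :=
  ereal_sup [set (baernstein_beta p x C)%:E | C in schreier_chain].

Definition ellp_norm (p : R) (x : vec) : \bar R :=
  ((\sum_(0 <= n <oo) (modulus (x n) `^ p)%:E) `^ p^-1)%E.

Definition sup_norm (x : vec) : \bar R :=
  ereal_sup (range (fun n => (modulus (x n))%:E)).

End SequenceSpaces.

Arguments seq_space : clear implicits.

Section Spaces.
Context {R : realType} (k : scalar_kind).

Definition baernstein_space (p : R) : seq_space R k :=
  finite_norm_space (baernstein_norm p).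

Definition schreier_space (p : R) : seq_space R k :=
  SeqSpace
    (closed_span (finite_norm_space (schreier_norm p)) (range unit_vec))
    (schreier_norm p).

Definition lp_space (p : R) : seq_space R k := finite_norm_space (ellp_norm p).

Definition c0_space : seq_space R k :=
  SeqSpace [set x : vec R k | modulus (x n) @[n --> \oo] --> (0 : R)] sup_norm.

End Spaces.

(* Main.v *)
Require Import Defs.
From HB Require Import structures.
From mathcomp Require Import all_boot all_order all_algebra finmap.
From mathcomp Require Import complex.
From mathcomp Require Import ring lra zify.
From mathcomp Require Import all_classical all_reals all_analysis.

Set Implicit Arguments.
Unset Strict Implicit.
Unset Printing Implicit Defensive.

Import Order.TTheory GRing.Theory Num.Theory.
Import numFieldNormedType.Exports.

Local Open Scope classical_set_scope.
Local Open Scope ring_scope.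

(**
  Let [P] be a bounded linear projection onto the closed span [W] of the
  vectors [w n = u n + t n *: unit_vec (m n)].  Every [y] in [W] is
  proportional to [w n] on the support of [w n], and [u n] has norm 1, so the
  coordinate of [y] at [m n] is at most [t n] times the norm of [y]
  ([closed_span_m_le]): inside [W] a large coordinate at [m n] must be paid for
  by a multiple of [u n] that is [1 / t n] times larger.  In particular the
  coordinate at [m n] of the image of [unit_vec (m n)] is O(t n), and since
  [P (w n) = w n], the coordinate at [m n] of [P (u n)] is [t n (1 - O(t n))],
  at least [t n / 2] once [n] is large.

  Look now at the block of the [2 ^ d] indices [n] with
  [2 ^ d <= n.+1 < 2 ^ d.+1], on which [t n = 1 / d.+1].  For a suitable choice
  of signs [e n], the off-diagonal terms of the matrix of coordinates at [m j]
  of [P (u n)] do no harm ([signs_diagonal_le]), so the coordinates of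
  [P (\sum_n e n *: u n)] at the points [m j] are, in the sense of the sum of
  [r]-th powers, as large as if they were all of size [1 / d.+1].  The points
  [m j] of one block form a Schreier set, hence the image has norm at least of
  order [(2 ^ d) `^ r^-1 / d.+1], where [r = p] in the Schreier space and
  [r = 1] in the Baernstein space.  Because the unit vector basis of [c_0], respectively [l_p], dominates [u], the signed sum
  itself has norm O((2 ^ d) `^ s), with [s = 0], respectively [s = p^-1].  In
  both cases [s < r^-1], and an exponential beats the factor [d.+1]:
  contradiction ([perturbed_not_complemented]).  The argument only needs a few
  properties shared by both norms; they are collected in [schreier_solid].

  A sequence [u] to start from is given by the normalised multiples
  [average z n] of the indicator functions of the annuli
  [4 ^ n <= i.+1 < 2 * 4 ^ n].  The measure that gives each annulus mass 1,
  spread evenly, has density at most [2 / i.+1] at [i], so every Schreier set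
  has measure at most 2 ([density_schreier]).  This gives domination by [c_0]
  in the Schreier space at once, and domination by [l_p] in the Baernstein
  space after applying the power mean inequality on each set of a chain.
*)

(** * Scalars and real inequalities *)

Section Modulus.
Context {R : realType} {k : scalar_kind}.
Implicit Types z w : scalars R k.

Lemma modulus_ge0 z : 0 <= modulus z.
Proof. by case: k z => [|] z /=; [exact: normr_ge0|case: z => a b /=; exact: sqrtr_ge0]. Qed.

Lemma modulus0 : modulus (0 : scalars R k) = 0.
Proof. by case: k => /=; [exact: normr0|exact: ComplexField.Normc.normc0]. Qed.

Lemma modulus1 : modulus (1 : scalars R k) = 1.
Proof. by case: k => /=; [exact: normr1|exact: ComplexField.Normc.normc1]. Qed.

Lemma modulusM z w : modulus (z * w) = modulus z * modulus w.
Proof. by case: k z w => /= z w; [exact: normrM|exact: ComplexField.Normc.normcM]. Qed.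

Lemma modulusN z : modulus (- z) = modulus z.
Proof. by case: k z => /= z; [exact: normrN|exact: normcN]. Qed.

Lemma modulusD z w : modulus (z + w) <= modulus z + modulus w.
Proof. by case: k z w => /= z w; [exact: ler_normD|exact: le_normcD]. Qed.

Lemma modulusB z w : modulus (z - w) <= modulus z + modulus w.
Proof. by rewrite -[in leRHS](modulusN w); exact: modulusD. Qed.

Lemma modulusV z : modulus z^-1 = (modulus z)^-1.
Proof. by case: k z => /= z; [exact: normfV|exact: ComplexField.Normc.normcV]. Qed.

Lemma modulus_nat n : modulus (n%:R : scalars R k) = n%:R.
Proof.
case: k => /=; first exact: normr_nat.
by rewrite -[_%:R]/(1 *+ n) normcMn ComplexField.Normc.normc1.
Qed.

Lemma modulus_eq0 z : modulus z = 0 -> z = 0.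
Proof. by case: k z => /= z; [move/normr0P/eqP|exact: ComplexField.Normc.eq0_normc]. Qed.

Lemma modulus_sign (b : bool) : modulus ((-1) ^+ b : scalars R k) = 1.
Proof. by case: b; rewrite ?expr1 ?expr0 ?modulusN modulus1. Qed.

End Modulus.

Lemma modulus_surj {R : realType} (k : scalar_kind) (r : R) :
  0 <= r -> exists z : scalars R k, modulus z = r.
Proof.
case: k => r0; [exists r|exists (r%:C)%C] => /=; first exact: ger0_norm.
by rewrite expr0n addr0 sqrtr_sqr ger0_norm.
Qed.

Section RealLemmas.
Context {R : realType}.
Implicit Types a b p x : R.

Lemma powR_le p a b : 0 <= p -> 0 <= a -> a <= b -> a `^ p <= b `^ p.
Proof.
move=> p0 a0 ab; apply: ge0_ler_powR => //; rewrite nnegrE //.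
exact: le_trans ab.
Qed.

Lemma powRVK p a : 0 < p -> 0 <= a -> (a `^ p) `^ p^-1 = a.
Proof. by move=> p0 a0; rewrite -powRrM divff ?gt_eqF// powRr1. Qed.

Lemma powRKV p a : 0 < p -> 0 <= a -> (a `^ p^-1) `^ p = a.
Proof. by move=> p0 a0; rewrite -powRrM mulVf ?gt_eqF// powRr1. Qed.

Lemma powR_le_inv p a b : 0 < p -> 0 <= a -> 0 <= b -> a `^ p <= b `^ p -> a <= b.
Proof.
move=> p0 a0 b0 h; rewrite -(powRVK p0 a0) -(powRVK p0 b0).
by apply: powR_le; rewrite ?invr_ge0 ?powR_ge0 // ltW.
Qed.

Lemma powRV_le p a c : 0 < p -> 0 <= a -> 0 <= c -> a `^ p^-1 <= c -> a <= c `^ p.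
Proof.
move=> p0 a0 c0 h; rewrite -(powRKV p0 a0).
by apply: powR_le; rewrite ?powR_ge0 // ltW.
Qed.

(** Two-point convexity of the power function with weights [s] and [t] that need
    not add up to 1.  The barycentre is an existential witness so that the case
    [s + t = 0] causes no division by zero when the statement is iterated. *)
Lemma powR_convex p s t x y :
  1 <= p -> 0 <= s -> 0 <= t -> 0 <= x -> 0 <= y ->
  exists z, [/\ 0 <= z, (s + t) * z = s * x + t * y &
    (s + t) * z `^ p <= s * x `^ p + t * y `^ p].
Proof.
move=> p1 s0 t0 x0 y0.
have [st0|st0] := eqVneq (s + t) 0.
  have [-> ->] : s = 0 /\ t = 0 by split; lra.
  by exists 0; rewrite !mul0r !addr0 !mul0r.
have stp : 0 < s + t by rewrite lt_neqAle eq_sym st0 addr_ge0.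
pose c := s / (s + t).
have c0 : 0 <= c by rewrite divr_ge0 // ltW.
have c1 : c <= 1 by rewrite ler_pdivrMr // mul1r; lra.
have c' : 1 - c = t / (s + t) by rewrite /c; field.
have cvx : (c * x + (1 - c) * y) `^ p <= c * x `^ p + (1 - c) * y `^ p.
  have := @convex_powR R p p1 (Itv01 c0 c1) x y.
  by rewrite !inE /= !in_itv /= !andbT => /(_ x0 y0).
exists (c * x + (1 - c) * y); split.
- by rewrite c' addr_ge0 // mulr_ge0 // divr_ge0 // ltW.
- by rewrite c' /c; field.
- move: cvx; rewrite -(ler_pM2l stp) => /le_trans; apply.
  by rewrite le_eqVlt; apply/orP; left; apply/eqP; rewrite c' /c; field.
Qed.

(** Power mean (Jensen) inequality, not normalised by the total weight. *)
Lemma powR_wmean (I : Type) (s : seq I) (w x : I -> R) p : 1 <= p ->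
  (forall i, 0 <= w i) -> (forall i, 0 <= x i) ->
  (\sum_(i <- s) w i * x i) `^ p <=
  (\sum_(i <- s) w i) `^ (p - 1) * \sum_(i <- s) w i * x i `^ p.
Proof.
move=> p1 w0 x0.
have p0 : 0 < p by exact: lt_le_trans p1.
have W0 (l : seq I) : 0 <= \sum_(i <- l) w i by exact: sumr_ge0.
have [z [z0 <-]] : exists z, [/\ 0 <= z,
    (\sum_(i <- s) w i) * z = \sum_(i <- s) w i * x i &
    (\sum_(i <- s) w i) * z `^ p <= \sum_(i <- s) w i * x i `^ p].
  elim: s => [|i s [z [z0 zE zp]]]; first by exists 0; rewrite !big_nil !mul0r.
  have [y [y0 yE yp]] := powR_convex p1 (w0 i) (W0 s) (x0 i) z0.
  exists y; rewrite !big_cons yE -zE; split => //.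
  by apply: (le_trans yp); rewrite lerD2l.
set W := \sum_(i <- s) w i; move=> zp.
rewrite powRM ?W0 // -mulr_powRB1 ?W0 // [W * _]mulrC -mulrA.
by apply: ler_wpM2l => //; exact: powR_ge0.
Qed.

Lemma bernoulli (d : R) n : 0 <= d -> 1 + n%:R * d <= (1 + d) ^+ n.
Proof.
move=> d0; elim: n => [|n IH]; first by rewrite expr0 mul0r addr0.
rewrite exprS -natr1; have n0 : 0 <= n%:R :> R by [].
have : (1 + d) * (1 + n%:R * d) <= (1 + d) * (1 + d) ^+ n.
  by rewrite ler_wpM2l // addr_ge0.
have ndd : 0 <= n%:R * (d * d) by rewrite !mulr_ge0.
by apply: le_trans; lra.
Qed.

(** Bernoulli's inequality, applied to the square root of [b ^+ n] for an even
    [n], makes [b ^+ n] grow at least quadratically. *)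
Lemma expr_gt_linear (b A : R) n0 : 1 < b ->
  exists2 n, (n0 <= n)%N & A * n.+1%:R < b ^+ n.
Proof.
move=> b1; pose d := b - 1; have d0 : 0 < d by rewrite subr_gt0.
pose l := (n0 + (Num.truncn (3 * `|A| / d ^+ 2)).+1)%N.
exists (l + l)%N; first by rewrite /l; lia.
have l1 : 1 <= l%:R :> R by rewrite ler1n /l; lia.
have lA : 3 * `|A| <= l%:R * d ^+ 2.
  rewrite -ler_pdivrMr ?exprn_gt0 //; apply: ltW.
  apply: (lt_le_trans (truncnS_gt _)).
  by rewrite ler_nat /l leq_addl.
have dl : 0 <= l%:R * d by rewrite mulr_ge0 ?ltW // (lt_le_trans ltr01).
have -> : b = 1 + d by rewrite /d; ring.
apply: (@lt_le_trans _ _ ((1 + l%:R * d) ^+ 2)); last first.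
  have d1 : 0 <= 1 + d by rewrite addr_ge0 // ltW.
  rewrite addnn -muln2 exprM; apply: lerXn2r.
  - by rewrite nnegrE addr_ge0.
  - by rewrite nnegrE exprn_ge0.
  - by apply: bernoulli; exact: ltW.
have -> : (l + l).+1%:R = 2 * l%:R + 1 :> R by rewrite -natr1 natrD; ring.
have AA : A <= `|A| by exact: ler_norm.
have A0 : 0 <= `|A| by [].
have h1 : A * (2 * l%:R + 1) <= `|A| * (3 * l%:R) by nra.
have h2 : `|A| * (3 * l%:R) <= l%:R * d ^+ 2 * l%:R by nra.
by nra.
Qed.

(** The comparison of exponents that decides the proof: [M `^ s * d.+1] cannot
    dominate [M `^ r^-1] along [M = 2 ^ d] when [s < r^-1].  The left-hand side
    is the upper bound for the sum of [r]-th powers over one block, the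
    right-hand side the lower bound. *)
Lemma powR_block_growth (r s A C : R) n0 : 0 < r -> 0 <= A -> 0 <= C -> s < r^-1 ->
  exists2 d, (n0 <= d)%N &
    2 * (C * (A * (2 ^ d)%:R `^ s)) `^ r < (2 ^ d)%:R * ((2 * d.+1%:R)^-1) `^ r.
Proof.
move=> r0 A0 C0 sr; pose b : R := 2 `^ (r^-1 - s).
have b1 : 1 < b.
  have <- : 1 `^ (r^-1 - s) = 1 :> R by rewrite powR1.
  by apply: gt0_ltr_powR; rewrite ?subr_gt0 ?nnegrE ?ltr1n.
pose B := 2 `^ r^-1 * (C * A) * 2.
have [d n0d dB] := expr_gt_linear B n0 b1; exists d => //.
set M : R := (2 ^ d)%:R; have M0 : 0 < M by rewrite ltr0n expn_gt0.
have bE : b ^+ d = M `^ r^-1 / M `^ s.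
  rewrite -powRB ?lt0r_neq0 ?implybT // /b -powR_mulrn ?powR_ge0 // -powRrM mulrC.
  by rewrite powRrM powR_mulrn // /M natrX.
have d0 : 0 < 2 * d.+1%:R :> R by rewrite mulr_gt0.
have Ms : 0 < M `^ s by exact: powR_gt0.
set X := C * _; have X0 : 0 <= X by rewrite /X mulr_ge0 // mulr_ge0 // ltW.
have -> : 2 * X `^ r = (2 `^ r^-1 * X) `^ r.
  by rewrite powRM ?powR_ge0 // powRKV.
have -> : M * (2 * d.+1%:R)^-1 `^ r = (M `^ r^-1 / (2 * d.+1%:R)) `^ r.
  by rewrite powRM ?powR_ge0 ?invr_ge0 ?(ltW d0) // powRKV // ltW.
apply: gt0_ltr_powR => //; first by rewrite nnegrE mulr_ge0 ?powR_ge0.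
  by rewrite nnegrE divr_ge0 ?powR_ge0 ?(ltW d0).
rewrite /X ltr_pdivlMr //; move: dB; rewrite bE ltr_pdivlMr // => h.
apply: le_lt_trans h; rewrite le_eqVlt; apply/orP; left; apply/eqP.
by rewrite /B; ring.
Qed.

End RealLemmas.

(** * Choice of signs *)

Section Signs.
Context {R : realType} {k : scalar_kind} (N : nat).
Local Notation K := (scalars R k).

Let signed_sum (a : 'I_N -> K) (e : {ffun 'I_N -> bool}) : K :=
  \sum_n (-1) ^+ e n * a n.

Let flip (j : 'I_N) (e : {ffun 'I_N -> bool}) : {ffun 'I_N -> bool} :=
  [ffun i => if i == j then ~~ e i else e i].

Let flipK j : involutive (flip j).
Proof. by move=> e; apply/ffunP => i; rewrite !ffunE; case: eqP => // _; exact: negbK. Qed.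

(** Changing the sign [e j] alone moves the signed sum by [2 * a j], so one of the
   two sums has modulus at least that of [a j]. *)
Let flip_sum_ge (a : 'I_N -> K) (r : R) (j : 'I_N) (e : {ffun 'I_N -> bool}) : 0 <= r ->
  modulus (a j) `^ r <=
  modulus (signed_sum a e) `^ r + modulus (signed_sum a (flip j e)) `^ r.
Proof.
move=> r0; set x := signed_sum a e; set y := signed_sum a (flip j e).
have xy : x - y = 2%:R * ((-1) ^+ e j * a j).
  rewrite /x /y /signed_sum (bigD1 j) //= [X in _ - X](bigD1 j) //= !ffunE eqxx.
  rewrite [X in _ + _ - (_ + X)](eq_bigr (fun n => (-1) ^+ e n * a n)); last first.
    by move=> i /negPf ij; rewrite ffunE ij.
  case: (e j); rewrite /= ?expr1 ?expr0; ring.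
have aj : modulus (a j) = 2^-1 * modulus (x - y).
  by rewrite xy !modulusM modulus_sign mul1r modulus_nat mulrA mulVf ?mul1r.
have := modulusB x y; have := modulus_ge0 x; have := modulus_ge0 y => y0 x0 h.
have [xley|ylex] := leP (modulus x) (modulus y).
  apply: (@le_trans _ _ (modulus y `^ r)); last by rewrite lerDr powR_ge0.
  by apply: powR_le => //; [exact: modulus_ge0|lra].
apply: (@le_trans _ _ (modulus x `^ r)); last by rewrite lerDl powR_ge0.
by apply: powR_le => //; [exact: modulus_ge0|lra].
Qed.

(** The inequality holds on average over all choices of signs: for each row [j],
    pair every choice with the one that differs from it in the sign [e j]. *)
Lemma signs_diagonal_le (a : 'I_N -> 'I_N -> K) (r : R) : 0 <= r ->
  exists e : {ffun 'I_N -> bool},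
  2^-1 * \sum_j modulus (a j j) `^ r <=
  \sum_j modulus (\sum_n (-1) ^+ e n * a j n) `^ r.
Proof.
move=> r0; set S := 2^-1 * _; apply: contrapT => /forallNP small.
have : \sum_(e : {ffun 'I_N -> bool}) \sum_j modulus (signed_sum (a j) e) `^ r
     < \sum_(e : {ffun 'I_N -> bool}) S.
  apply: ltr_sum; first by apply/hasP; exists [ffun=> true]; rewrite ?mem_index_enum.
  by move=> e _; rewrite ltNge; apply/negP; exact: small.
apply/negP; rewrite -leNgt exchange_big /= /S.
under eq_bigr do rewrite mulr_sumr.
rewrite exchange_big; apply: ler_sum => j _ /=.
rewrite -mulr_sumr -(ler_pM2l (ltr0Sn R 1)) mulrA divff // mul1r.
rewrite mulr_natl mulr2n [X in _ <= X + _](reindex_inj (inv_inj (flipK j))) /=.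
rewrite -big_split /=; apply: ler_sum => e _.
by rewrite addrC; exact: flip_sum_ge.
Qed.

End Signs.

(** * Finitely supported vectors and block sequences *)

Section FiniteSupport.
Context {R : realType} {k : scalar_kind}.
Local Notation K := (scalars R k).
Local Notation vec := (vec R k).

Definition finitely_supported (x : vec) : Prop :=
  exists n0, forall i, (n0 <= i)%N -> x i = 0.

Lemma finitely_supportedD (x y : vec) :
  finitely_supported x -> finitely_supported y -> finitely_supported (x + y).
Proof.
move=> [n hn] [l hl]; exists (maxn n l) => i; rewrite geq_max => /andP[ni li].
by rewrite -[LHS]/(x i + y i) hn // hl // addr0.
Qed.

Lemma finitely_supportedZ (a : K) (x : vec) :
  finitely_supported x -> finitely_supported (a *: x).
Proof. by move=> [n hn]; exists n => i ni; rewrite -[LHS]/(a * x i) hn // mulr0. Qed.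

Lemma finitely_supported_sum n (a : 'I_n -> K) (y : 'I_n -> vec) :
  (forall i, finitely_supported (y i)) ->
  finitely_supported (\sum_(i < n) a i *: y i).
Proof.
move=> fy; elim/big_ind: _ => [|x z|i _]; first by exists 0%N.
  exact: finitely_supportedD.
exact: finitely_supportedZ.
Qed.

Lemma finitely_supported_unit n : finitely_supported (unit_vec n : vec).
Proof. by exists n.+1 => i ni; rewrite /unit_vec gtn_eqF. Qed.

Lemma lin_combE n (a : 'I_n -> K) (y : 'I_n -> vec) j :
  (\sum_(i < n) a i *: y i) j = \sum_(i < n) a i * y i j :> K.
Proof. by rewrite fct_sumE. Qed.

Lemma unit_combE n (a : nat -> K) j :
  (\sum_(i < n) a i *: (unit_vec i : vec)) j = if (j < n)%N then a j else 0.
Proof.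
rewrite lin_combE /unit_vec; case: ltnP => [jn|nj].
  rewrite (bigD1 (Ordinal jn)) //= eqxx mulr1 big1 ?addr0 // => i ij.
  by rewrite (_ : (j == i :> nat) = false) ?mulr0 // eq_sym; exact/negbTE.
by rewrite big1 // => i _; rewrite gtn_eqF ?mulr0 //; exact: leq_trans nj.
Qed.

Lemma supp_nonempty (x : vec) : x <> 0 -> exists i, supp x i.
Proof.
move=> x0; apply: contrapT => /forallNP h; apply: x0; apply/funext => i.
by have /negP := h i; rewrite negbK => /eqP.
Qed.

Lemma notin_supp (x : vec) i : ~ supp x i -> x i = 0.
Proof. by move/negP; rewrite negbK => /eqP. Qed.

Lemma block_basic_lt (u : nat -> vec) n j : block_basic u -> (n < j)%N ->
  set_lt (supp (u n)) (supp (u j)).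
Proof.
move=> [u0 _ lt_u]; elim: j => // j IH; rewrite ltnS leq_eqVlt => /orP[/eqP ->|nj].
  exact: lt_u.
move=> i l ui ul; have [a ua] := supp_nonempty (u0 j).
exact: ltn_trans (IH nj _ _ ui ua) (lt_u _ _ _ ua ul).
Qed.

Lemma block_basic_disjoint (u : nat -> vec) n j i : block_basic u -> n != j ->
  supp (u j) i -> u n i = 0.
Proof.
move=> bu nj ji; apply: notin_supp => ni.
by have [nj'|nj'|] := ltngtP n j;
  [have := block_basic_lt bu nj' ni ji|have := block_basic_lt bu nj' ji ni
  |move/eqP; rewrite (negPf nj)]; rewrite ?ltnn.
Qed.

Lemma block_basic_finitely_supported (u : nat -> vec) n : block_basic u ->
  finitely_supported (u n).
Proof.
move=> [u0 _ lt_u]; have [a ua] := supp_nonempty (u0 n.+1); exists a => i ai.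
by apply: notin_supp => ni; have := lt_u _ _ _ ni ua; rewrite ltnNge ai.
Qed.

End FiniteSupport.

(** * Uncomplemented perturbed block sequences *)

Section Core.
Context {R : realType} {k : scalar_kind}.
Local Notation K := (scalars R k).
Local Notation vec := (vec R k).

(** What the argument uses of the Schreier and Baernstein norms.  The exponent
    [r] is the one with which the norm controls the coordinates on a single
    Schreier set: [p] for the Schreier space and 1 for the Baernstein space.
    In [ss_mono], which expresses that the norm is monotone in the moduli of
    the coordinates and homogeneous, norms are compared with real bounds [c]
    to stay away from extended real arithmetic. *)
Record schreier_solid (E : seq_space R k) (r : R) : Prop := SchreierSolid {
  ss_finite : forall x, finitely_supported x -> ss_carrier E x;
  ss_norm0 : ss_norm E 0 = 0%E;
  ss_ge0 : forall x, (0 <= ss_norm E x)%E;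
  ss_unit : forall i, (ss_norm E (unit_vec i) <= 1)%E;
  ss_mono : forall x y (a b c : R), 0 <= a -> 0 <= b -> 0 <= c ->
    ss_norm E x = 1%E -> (ss_norm E y <= c%:E)%E ->
    (forall i, a * modulus (x i) <= b * modulus (y i)) -> a <= b * c;
  ss_schreier : forall x (c : R) (F : {fset nat}), 0 <= c -> schreier_set F ->
    (ss_norm E x <= c%:E)%E -> \sum_(i <- F) modulus (x i) `^ r <= c `^ r }.

Lemma schreier_set1 i : schreier_set [fset i]%fset.
Proof. by move=> j _; rewrite cardfs1. Qed.

Lemma coord_le E r x c i : 0 < r -> schreier_solid E r -> 0 <= c ->
  (ss_norm E x <= c%:E)%E -> modulus (x i) <= c.
Proof.
move=> r0 HE c0 xc; apply: (powR_le_inv r0) => //; first exact: modulus_ge0.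
have := ss_schreier HE c0 (@schreier_set1 i) xc.
by rewrite big_seq_fset1.
Qed.

Section Perturbed.
Context (E : seq_space R k) (r : R) (r0 : 0 < r) (HE : schreier_solid E r).
Context (u : nat -> vec) (bu : block_basic u) (nu : normalized E u).
Context (m : nat -> nat).
Context (hm : forall n, set_lt (supp (u n)) [set m n] /\
                        set_lt [set m n] (supp (u n.+1))).
Context (t : nat -> K) (t0 : forall n, t n != 0).

Definition perturbed (n : nat) : vec := u n + t n *: unit_vec (m n).
Local Notation w := perturbed.

Lemma u_at_m n : u n (m n) = 0.
Proof. by apply: notin_supp => h; have := (hm n).1 _ _ h erefl; rewrite ltnn. Qed.

Lemma perturbed_at_m n : w n (m n) = t n.
Proof.
rewrite -[LHS]/(u n (m n) + t n * unit_vec (m n) (m n)) u_at_m.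
by rewrite /unit_vec eqxx mulr1 add0r.
Qed.

Lemma perturbed_at_u n i : supp (u n) i -> w n i = u n i.
Proof.
move=> ni; rewrite -[LHS]/(u n i + t n * unit_vec (m n) i) /unit_vec.
by rewrite ltn_eqF ?mulr0 ?addr0 //; exact: (hm n).1 ni erefl.
Qed.

Lemma supp_perturbed n i : supp (w n) i -> supp (u n) i \/ i = m n.
Proof.
have [->|im] := eqVneq i (m n); first by right.
rewrite /supp /= -[w n i]/(u n i + t n * unit_vec (m n) i) /unit_vec (negPf im).
by rewrite mulr0 addr0; left.
Qed.

Lemma m_lt n : (m n < m n.+1)%N.
Proof.
have [u0 _ _] := bu; have [a ua] := supp_nonempty (u0 n.+1).
exact: ltn_trans ((hm n).2 _ _ erefl ua) ((hm n.+1).1 _ _ ua erefl).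
Qed.

Lemma m_ge n : (n <= m n)%N.
Proof. by elim: n => // n IH; exact: leq_ltn_trans IH (m_lt n). Qed.

Lemma m_inj : injective m.
Proof.
have mlt a b : (a < b -> m a < m b)%N.
  elim: b => // b IH; rewrite ltnS leq_eqVlt => /orP[/eqP ->|ab]; first exact: m_lt.
  exact: ltn_trans (IH ab) (m_lt b).
move=> a b ab; have [/mlt|/mlt|//] := ltngtP a b; by rewrite ab ltnn.
Qed.

Lemma block_basic_perturbed : block_basic w.
Proof.
have [u0 _ lt_u] := bu; split.
- move=> n wn; have := perturbed_at_m n; rewrite wn => /esym/eqP; exact/negP/t0.
- move=> n; apply: (sub_finite_set (B := `I_(m n).+1)); last exact: finite_II.
  move=> i /supp_perturbed[ui|->] /=; last exact: ltnSn.
  by rewrite ltnS ltnW //; exact: (hm n).1 ui erefl.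
- move=> n i j /supp_perturbed[ui|->] /supp_perturbed[uj|->].
  + exact: lt_u ui uj.
  + exact: ltn_trans ((hm n).1 _ _ ui erefl) (m_lt n).
  + exact: (hm n).2 erefl uj.
  + exact: m_lt.
Qed.

(** On the support of [w j], every element of the closed span is a multiple of
    [w j].  This is a linear relation between two coordinates, and coordinates
    are continuous, so it passes from the generators to the closed span. *)
Lemma closed_span_ratio y j i : closed_span E (range w) y -> supp (u j) i ->
  y (m j) * u j i = t j * y i.
Proof.
move=> [_ yW] ji; have bw := block_basic_perturbed.
have wi : supp (w j) i by rewrite /supp /= perturbed_at_u.
have wm : supp (w j) (m j) by rewrite /supp /= perturbed_at_m.
have w_ratio n : w n (m j) * u j i = t j * w n i.
  have [->|nj] := eqVneq n j; first by rewrite perturbed_at_m perturbed_at_u.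
  by rewrite !(block_basic_disjoint bw nj) // mulr0 mul0r.
apply/eqP; rewrite -subr_eq0; apply/eqP/modulus_eq0/eqP.
rewrite eq_le modulus_ge0 andbT; apply/ler_addgt0Pl => e e0; rewrite addr0.
(* A uniform error [e / c] on the coordinates of [y] changes the difference of
   the two sides by at most [e]. *)
pose c := modulus (u j i) + modulus (t j) + 1.
have c0 : 0 < c by rewrite ltr_wpDl ?addr_ge0 ?modulus_ge0.
have ec0 : 0 < e / c by rewrite divr_gt0.
have [y' [n [a [v [vw y'E]]]] yy'] := yW _ ec0.
have y'_ratio : y' (m j) * u j i = t j * y' i.
  rewrite y'E !lin_combE mulr_suml mulr_sumr; apply: eq_bigr => l _.
  by have [q _ <-] := vw l; rewrite -mulrA w_ratio mulrCA.
have cle l : modulus (y l - y' l) <= e / c.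
  exact: (coord_le (x := y - y') l r0 HE (ltW ec0) (ltW yy')).
have -> : y (m j) * u j i - t j * y i
        = (y (m j) - y' (m j)) * u j i - t j * (y i - y' i).
  by rewrite mulrBl mulrBr y'_ratio; ring.
apply: (le_trans (modulusB _ _)); rewrite !modulusM.
have h1 := ler_wpM2r (modulus_ge0 (u j i)) (cle (m j)).
have h2 := ler_wpM2l (modulus_ge0 (t j)) (cle i).
have -> : e = e / c * modulus (u j i) + modulus (t j) * (e / c) + e / c.
  by rewrite -[LHS](divfK (lt0r_neq0 c0)) [in LHS]/c; ring.
lra.
Qed.

(** If [y] is [c *: w j] on the support of [w j], then it is [c *: u j] on the
    support of [u j], so its norm is at least the modulus of [c], while its
    coordinate at [m j] is [c * t j]. *)
Lemma closed_span_m_le y j c : closed_span E (range w) y -> 0 <= c ->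
  (ss_norm E y <= c%:E)%E -> modulus (y (m j)) <= modulus (t j) * c.
Proof.
move=> yW c0 yc.
apply: (ss_mono HE (x := u j) (y := y)); rewrite ?modulus_ge0 //.
move=> i; have [ji|/notin_supp ->] := pselect (supp (u j) i).
  by rewrite -!modulusM (closed_span_ratio yW ji).
by rewrite modulus0 mulr0 mulr_ge0 // modulus_ge0.
Qed.

Lemma perturbed_in_closed_span n : closed_span E (range w) (w n).
Proof.
split.
  exact: (ss_finite HE (block_basic_finitely_supported n block_basic_perturbed)).
move=> e e0; exists (w n).
  exists 1%N, (fun=> 1), (fun=> w n); split; first by move=> _; exists n.
  by rewrite big_ord1 scale1r.
by rewrite subrr (ss_norm0 HE) lte_fin.
Qed.

(** The contradiction described at the top: [A] and [s] bound the norms of the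
    signed sums of the [u n] over a block, and the hypothesis [s < r^-1] says
    that these grow more slowly than the sums of the [unit_vec (m n)]. *)
Theorem perturbed_not_complemented (s A : R) : 0 <= A -> s < r^-1 ->
  (forall d (e : 'I_(2 ^ d) -> bool),
    (ss_norm E (\sum_(i < 2 ^ d) ((-1) ^+ e i : K) *: u ((2 ^ d).-1 + i)%N)%R
      <= (A * (2 ^ d)%:R `^ s)%:E)%E) ->
  (forall d i, (i < 2 ^ d)%N -> modulus (t ((2 ^ d).-1 + i)%N) = d.+1%:R^-1) ->
  ~ complemented E (closed_span E (range w)).
Proof.
move=> A0 sr upper tE [P [_ Plin [C0 PC] Pid Pim]].
pose C := `|C0|; have C_ge0 : 0 <= C by rewrite normr_ge0.
have P_le x c : ss_carrier E x -> (ss_norm E x <= c%:E)%E ->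
    (ss_norm E (P x) <= (C * c)%:E)%E.
  move=> Ex xc; apply: (le_trans (PC x Ex)).
  apply: (@le_trans _ _ (C%:E * ss_norm E x)%E).
    by apply: lee_wpmul2r; [exact: (ss_ge0 HE)|rewrite lee_fin ler_norm].
  by rewrite EFinM; apply: lee_wpmul2l; rewrite ?lee_fin.
have PW x : ss_carrier E x -> closed_span E (range w) (P x).
  by move=> Ex; rewrite -Pim; exists x.
have Pw j : P (w j) = w j.
  have : closed_span E (range w) (w j) by exact: perturbed_in_closed_span.
  by rewrite -Pim => -[x Ex <-]; exact: Pid.
have Ee n : ss_carrier E (unit_vec n).
  exact: (ss_finite HE (finitely_supported_unit n)).
have fu n : finitely_supported (u n) by exact: block_basic_finitely_supported.
have Eu n : ss_carrier E (u n) by exact: (ss_finite HE (fu n)).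
have P0 : P 0 = 0.
  have E0 : ss_carrier E 0 by apply: (ss_finite HE); exists 0%N.
  have := Plin 1 0 0 E0 E0; rewrite scale1r add0r scale1r => /eqP.
  by rewrite -subr_eq0 opprD addrA subrr sub0r oppr_eq0 => /eqP.
have Psum n (a : 'I_n -> K) (y : 'I_n -> vec) :
    (forall i, finitely_supported (y i)) ->
    P (\sum_(i < n) a i *: y i) = \sum_(i < n) a i *: P (y i).
  move=> fy; elim: n a y fy => [|n IH] a y fy; first by rewrite !big_ord0.
  rewrite !big_ord_recl Plin ?IH //; first exact: (ss_finite HE).
  by apply: (ss_finite HE); exact: finitely_supported_sum.
have diag j : modulus (t j) - modulus (t j) * (modulus (t j) * C)
    <= modulus (P (u j) (m j)).
  have tj : t j = t j * P (unit_vec (m j)) (m j) + P (u j) (m j).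
    rewrite -[LHS](perturbed_at_m j) -{1}Pw /perturbed [X in P X]addrC Plin //.
  have := closed_span_m_le j (PW _ (Ee (m j))) C_ge0.
  have := P_le _ 1 (Ee (m j)) (ss_unit HE _); rewrite mulr1 => h /(_ h) Pe.
  have -> : P (u j) (m j) = t j - t j * P (unit_vec (m j)) (m j).
    by rewrite {1}tj; ring.
  have tb := modulusD (t j - t j * P (unit_vec (m j)) (m j))
                      (t j * P (unit_vec (m j)) (m j)).
  rewrite subrK modulusM in tb.
  have := ler_wpM2l (modulus_ge0 (t j)) Pe; lra.
(* [2 * C <= d.+1] makes [t (1 - t C) >= t / 2] for the value [t = d.+1^-1] of
   the coefficients on the block of length [2 ^ d]. *)
have [d Cd growth] := powR_block_growth (Num.truncn (2 * C)).+1 r0 A0 C_ge0 sr.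
pose J (i : 'I_(2 ^ d)) := ((2 ^ d).-1 + i)%N.
have lower i : (2 * d.+1%:R)^-1 <= modulus (P (u (J i)) (m (J i))).
  apply: le_trans (diag (J i)); rewrite tE //.
  have dC : 2 * C <= d.+1%:R.
    apply: ltW; apply: (lt_le_trans (truncnS_gt _)); rewrite ler_nat; exact: leqW.
  have d0 : 0 < d.+1%:R :> R by [].
  rewrite invfM; set v := d.+1%:R^-1; have v0 : 0 < v by rewrite invr_gt0.
  have vC : v * C <= 2^-1.
    by rewrite mulrC ler_pdivrMr //; lra.
  have := ler_wpM2l (ltW v0) vC; lra.
have [e he] := @signs_diagonal_le R k (2 ^ d)
  (fun j n => P (u (J n)) (m (J j))) r (ltW r0).
pose x := \sum_(i < 2 ^ d) ((-1) ^+ e i : K) *: u (J i).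
have Ex : ss_carrier E x.
  by apply: (ss_finite HE); exact: finitely_supported_sum.
have Px_le := P_le _ _ Ex (upper d e).
have F_schreier : schreier_set [fset m (J i) | i in 'I_(2 ^ d)]%fset.
  move=> _ /imfsetP[i _ ->]; rewrite card_imfset /=; last first.
    by move=> a b /m_inj/addnI/val_inj.
  rewrite -cardE card_ord; apply: leq_trans (_ : (J i).+1 <= _)%N; last exact: m_ge.
  by rewrite /J -addSn prednK ?expn_gt0 // leq_addr.
have := ss_schreier HE (mulr_ge0 C_ge0 (mulr_ge0 A0 (powR_ge0 _ _))) F_schreier Px_le.
rewrite big_imfset /=; last by move=> a b _ _ /m_inj/addnI/val_inj.
rewrite big_enum /= Psum //.
under eq_bigr do rewrite lin_combE.
move/(le_trans he); apply/negP; rewrite -ltNge.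
rewrite -(ltr_pM2l (ltr0Sn R 1)) mulVKf //.
apply: (lt_le_trans growth).
rewrite mulr_natl -[X in _ *+ X]card_ord -sumr_const; apply: ler_sum => i _.
by apply: powR_le; rewrite ?(ltW r0) ?invr_ge0 ?mulr_ge0.
Qed.

End Perturbed.
End Core.

(** * The Schreier and Baernstein norms *)

Section FiniteSums.
Context {R : realType}.

Lemma sum_uniq_le (g : nat -> R) n0 (s : seq nat) : uniq s ->
  (forall i, 0 <= g i) -> (forall i, (n0 <= i)%N -> g i = 0) ->
  \sum_(i <- s) g i <= \sum_(i < n0) g i.
Proof.
move=> us g0 gn0; rewrite (bigID (fun i => i < n0)%N) /= [X in _ + X]big1; last first.
  by move=> i; rewrite -leqNgt; exact: gn0.
rewrite addr0 -big_filter (perm_big [seq i <- iota 0 n0 | i \in s]); last first.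
  apply: uniq_perm; rewrite ?filter_uniq ?iota_uniq // => i.
  by rewrite !mem_filter mem_iota /= andbC.
rewrite big_filter big_mkcond -[in leRHS](big_mkord xpredT g) /index_iota subn0.
by apply: ler_sum => i _; case: ifP.
Qed.

Lemma schreier_chain_uniq (C : seq {fset nat}) : schreier_chain C ->
  uniq (flatten [seq enum_fset F | F : {fset nat} <- C]).
Proof.
move=> [_ neC]; set lt := (fun F G : {fset nat} => _).
pose ne (F : {fset nat}) := F != fset0.
have all_ne : all ne C by apply/allP => F /neC[/eqP].
rewrite (sorted_pairwise_in _ all_ne); last first.
  move=> G F H /fset0Pn[g gG] _ _ /allrelP FG /allrelP GH.
  apply/allrelP => a b aF bH; exact: ltn_trans (FG _ _ aF gG) (GH _ _ gG bH).
elim: C {neC all_ne} => //= F C IH /andP[/allP FC /IH uC].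
rewrite cat_uniq fset_uniq uC andbT /=; apply/hasPn => i /flatten_mapP[G GC iG].
apply/negP => iF; have /allrelP FG := FC _ GC.
by have /= := FG _ _ iF iG; rewrite ltnn.
Qed.

(** The sets of a chain are pairwise disjoint, so summing over all of them
    counts each index at most once. *)
Lemma sum_schreier_chain_le (g : nat -> R) n0 (C : seq {fset nat}) :
  schreier_chain C -> (forall i, 0 <= g i) -> (forall i, (n0 <= i)%N -> g i = 0) ->
  \sum_(F <- C) \sum_(i <- F) g i <= \sum_(i < n0) g i.
Proof.
move=> /schreier_chain_uniq uC g0 gn0.
rewrite (_ : \sum_(F <- C) _ =
  \sum_(i <- flatten [seq enum_fset F | F : {fset nat} <- C]) g i).
  exact: sum_uniq_le.
by rewrite big_flatten big_map.
Qed.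

(** Both norms are suprema of seminorms; this transfers [ss_mono] from the
    seminorms to their supremum. *)
Lemma ereal_sup_solid (I : Type) (S : set I) (f g : I -> R) a b c :
  0 <= a -> 0 <= b -> 0 <= c ->
  ereal_sup [set (f i)%:E | i in S] = 1%E ->
  (ereal_sup [set (g i)%:E | i in S] <= c%:E)%E ->
  (forall i, S i -> a * f i <= b * g i) -> a <= b * c.
Proof.
move=> a0 b0 c0 f1 gc fg; have [->|an0] := eqVneq a 0; first exact: mulr_ge0.
have a_gt0 : 0 < a by rewrite lt_neqAle eq_sym an0.
have : (1 <= (b * c / a)%:E)%E.
  rewrite -f1; apply: ge_ereal_sup => _ [i Si <-].
  rewrite lee_fin ler_pdivlMr // mulrC; apply: (le_trans (fg i Si)).
  rewrite ler_wpM2l // -lee_fin; apply: le_trans gc.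
  by apply: ereal_sup_ubound; exists i.
by rewrite lee_fin ler_pdivlMr // mul1r.
Qed.

End FiniteSums.

Section Spaces.
Context {R : realType} {k : scalar_kind}.
Local Notation K := (scalars R k).
Local Notation vec := (vec R k).
Implicit Types (x y : vec) (p : R).

Lemma schreier_muZ p a x (F : {fset nat}) : 0 < p -> 0 <= a ->
  a * schreier_mu p x F = (\sum_(n <- F) (a * modulus (x n)) `^ p) `^ p^-1.
Proof.
move=> p0 a0; under eq_bigr => n _ do rewrite powRM ?modulus_ge0 //.
rewrite -mulr_sumr powRM ?powR_ge0 ?powRVK // sumr_ge0 // => n _.
exact: powR_ge0.
Qed.

Lemma baernstein_betaZ p a x (C : seq {fset nat}) : 0 < p -> 0 <= a ->
  a * baernstein_beta p x C =
  (\sum_(F <- C) (\sum_(n <- F) a * modulus (x n)) `^ p) `^ p^-1.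
Proof.
move=> p0 a0; under eq_bigr => F _.
  rewrite -mulr_sumr powRM ?sumr_ge0 //; last by move=> n _; exact: modulus_ge0.
  over.
rewrite -mulr_sumr powRM ?powR_ge0 ?sumr_ge0 ?powRVK // => F _; exact: powR_ge0.
Qed.

Lemma schreier_mu_le p x (F : {fset nat}) c : 0 < p -> 0 <= c ->
  \sum_(n <- F) modulus (x n) `^ p <= c `^ p -> schreier_mu p x F <= c.
Proof.
move=> p0 c0 h; rewrite /schreier_mu -[leRHS](powRVK p0 c0).
apply: powR_le => //; first by rewrite invr_ge0 ltW.
by apply: sumr_ge0 => n _; exact: powR_ge0.
Qed.

Lemma baernstein_beta_le p x (C : seq {fset nat}) c : 0 < p -> 0 <= c ->
  \sum_(F <- C) (\sum_(n <- F) modulus (x n)) `^ p <= c `^ p ->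
  baernstein_beta p x C <= c.
Proof.
move=> p0 c0 h; rewrite /baernstein_beta -[leRHS](powRVK p0 c0).
apply: powR_le => //; first by rewrite invr_ge0 ltW.
by apply: sumr_ge0 => F _; exact: powR_ge0.
Qed.

Lemma schreier_norm_le p x n0 c : 0 < p -> 0 <= c ->
  (forall i, (n0 <= i)%N -> x i = 0) -> \sum_(i < n0) modulus (x i) `^ p <= c `^ p ->
  (schreier_norm p x <= c%:E)%E.
Proof.
move=> p0 c0 xn0 h; apply: ge_ereal_sup => _ [F _ <-].
rewrite lee_fin; apply: schreier_mu_le => //; apply: le_trans h.
apply: (sum_uniq_le (g := fun i => modulus (x i) `^ p)) => //.
- exact: fset_uniq.
- by move=> i; exact: powR_ge0.
- by move=> i /xn0 ->; rewrite modulus0 powR0 ?gt_eqF.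
Qed.

(** The [l_1] norm dominates the Baernstein norm, since
    [\sum_F s_F ^ p <= (\sum_F s_F) ^ p] for nonnegative reals. *)
Lemma baernstein_norm_le p x n0 : 1 <= p ->
  (forall i, (n0 <= i)%N -> x i = 0) ->
  (baernstein_norm p x <= (\sum_(i < n0) modulus (x i))%:E)%E.
Proof.
move=> p1 xn0; have p0 : 0 < p by exact: lt_le_trans p1.
have mx0 i : 0 <= modulus (x i) by exact: modulus_ge0.
have xn0' i : (n0 <= i)%N -> modulus (x i) = 0 by move/xn0 ->; exact: modulus0.
apply: ge_ereal_sup => _ [C chainC <-]; set S := \sum_(i < n0) _.
have S0 : 0 <= S by exact: sumr_ge0.
rewrite lee_fin; apply: baernstein_beta_le => //.
rewrite -(mulr_powRB1 S0 p0) mulrC.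
apply: (@le_trans _ _ (S `^ (p - 1) * \sum_(F <- C) \sum_(n <- F) modulus (x n))).
  rewrite mulr_sumr; apply: ler_sum => F _.
  have F0 : 0 <= \sum_(n <- F) modulus (x n) by exact: sumr_ge0.
  rewrite -(mulr_powRB1 F0 p0) mulrC ler_wpM2r // powR_le ?subr_ge0 //.
  exact: (sum_uniq_le (g := fun i => modulus (x i)) (fset_uniq F)).
rewrite ler_wpM2l ?powR_ge0 //.
exact: (sum_schreier_chain_le (g := fun i => modulus (x i))).
Qed.

Lemma unit_vec_supp n i : (n.+1 <= i)%N -> (unit_vec n : vec) i = 0.
Proof. by move=> ni; rewrite /unit_vec gtn_eqF. Qed.

Lemma modulus_unit_vec n i : modulus ((unit_vec n : vec) i) = (i == n)%:R.
Proof. by rewrite /unit_vec modulus_nat. Qed.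

Lemma sum_delta n : \sum_(i < n.+1) ((i : nat) == n)%:R = 1 :> R.
Proof.
rewrite big_ord_recr /= eqxx big1 ?add0r // => i _.
by rewrite ltn_eqF.
Qed.

Lemma schreier_schreier_solid p : 1 <= p -> schreier_solid (schreier_space k p) p.
Proof.
move=> p1; have p0 : 0 < p by exact: lt_le_trans p1.
have N0 : schreier_norm p (0 : vec) = 0%E.
  apply/eqP; rewrite eq_le; apply/andP; split.
    by apply: (schreier_norm_le (n0 := 0)); rewrite ?big_ord0 ?powR_ge0.
  apply: le_ereal_sup_tmp; exists (schreier_mu p (0 : vec) fset0)%:E.
    by exists fset0.
  by rewrite lee_fin powR_ge0.
split => /=.
- move=> x [n0 xn0]; split => /=.
    pose S := \sum_(i < n0) modulus (x i) `^ p.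
    have S0 : 0 <= S by apply: sumr_ge0 => i _; exact: powR_ge0.
    apply: (@le_lt_trans _ _ (S `^ p^-1)%:E); last exact: ltry.
    by apply: (schreier_norm_le (n0 := n0)); rewrite ?powR_ge0 ?powRKV.
  move=> e e0; exists x; last by rewrite subrr /= N0 lte_fin.
  exists n0, (fun i => x i), (fun i => unit_vec i); split; first by move=> i; exists i.
  by apply/funext => j; rewrite unit_combE; case: ltnP => // /xn0.
- exact: N0.
- move=> x; apply: le_ereal_sup_tmp; exists (schreier_mu p x fset0)%:E.
    by exists fset0.
  by rewrite lee_fin powR_ge0.
- move=> i; apply: (schreier_norm_le p0 _ (@unit_vec_supp i)) => //.
  rewrite powR1 -(sum_delta i); apply: ler_sum => j _.
  rewrite modulus_unit_vec; case: eqP => _; rewrite ?powR1 // powR0 ?gt_eqF //.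
- move=> x y a b c a0 b0 c0 x1 yc xy.
  apply: (ereal_sup_solid a0 b0 c0 x1 yc) => F _.
  rewrite (schreier_muZ x F p0 a0) (schreier_muZ y F p0 b0); apply: powR_le.
  + by rewrite invr_ge0 ltW.
  + by apply: sumr_ge0 => n _; exact: powR_ge0.
  + apply: ler_sum => n _; apply: powR_le => //; first exact: ltW.
    by apply: mulr_ge0 => //; exact: modulus_ge0.
- move=> x c F c0 schF xc.
  apply: (powRV_le p0 _ c0); first by apply: sumr_ge0 => n _; exact: powR_ge0.
  by rewrite -lee_fin; apply: le_trans xc; apply: ereal_sup_ubound; exists F.
Qed.

Lemma baernstein_schreier_solid p : 1 < p ->
  schreier_solid (baernstein_space k p) 1.
Proof.
move=> p1; have p0 : 0 < p by exact: lt_trans p1.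
have chain0 : schreier_chain [:: [fset 0%N]%fset].
  split => // F; rewrite inE => /eqP ->; split; last exact: schreier_set1.
  by apply/eqP/fset0Pn; exists 0%N; rewrite inE.
have N_ge0 (x : vec) : (0 <= baernstein_norm p x)%E.
  apply: le_ereal_sup_tmp; exists (baernstein_beta p x [:: [fset 0%N]%fset])%:E.
    by exists [:: [fset 0%N]%fset].
  by rewrite lee_fin powR_ge0.
split => //=.
- move=> x [n0 xn0]; apply: le_lt_trans (baernstein_norm_le (ltW p1) xn0) _.
  exact: ltry.
- apply/eqP; rewrite eq_le N_ge0 andbT.
  by have := @baernstein_norm_le p 0 0 (ltW p1); rewrite big_ord0; exact.
- move=> i; apply: (le_trans (baernstein_norm_le (ltW p1) (@unit_vec_supp i))).
  rewrite lee_fin -(sum_delta i); apply: ler_sum => j _.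
  by rewrite modulus_unit_vec.
- move=> x y a b c a0 b0 c0 x1 yc xy.
  apply: (ereal_sup_solid a0 b0 c0 x1 yc) => C _.
  rewrite (baernstein_betaZ x C p0 a0) (baernstein_betaZ y C p0 b0).
  apply: powR_le; first by rewrite invr_ge0 ltW.
    by apply: sumr_ge0 => F _; exact: powR_ge0.
  apply: ler_sum => F _; apply: powR_le; first exact: ltW.
    by apply: sumr_ge0 => n _; apply: mulr_ge0 => //; exact: modulus_ge0.
  by apply: ler_sum => n _; exact: xy.
- move=> x c F c0 schF xc; rewrite powRr1 //.
  have [->|Fn0] := eqVneq F fset0; first by rewrite big_seq_fset0.
  under eq_bigr do rewrite powRr1 ?modulus_ge0 //.
  rewrite -lee_fin; apply: le_trans xc; apply: ereal_sup_ubound; exists [:: F].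
    by split => // G; rewrite inE => /eqP ->; split => //; exact/eqP.
  rewrite /baernstein_beta big_seq1 powRVK // sumr_ge0 // => n _.
  exact: modulus_ge0.
Qed.

End Spaces.

(** * Domination and the perturbation theorem *)

Section Domination.
Context {R : realType} {k : scalar_kind}.
Local Notation K := (scalars R k).
Local Notation vec := (vec R k).

Lemma ellp_norm_comb (p : R) n (a : nat -> K) : 0 < p ->
  ellp_norm p (\sum_(i < n) a i *: (unit_vec i : vec)) =
  ((\sum_(i < n) modulus (a i) `^ p) `^ p^-1)%:E.
Proof.
move=> p0; rewrite /ellp_norm (nneseries_split 0 n) => [|j _]; last first.
  by rewrite lee_fin powR_ge0.
rewrite add0n eseries0 ?adde0 => [|j nj _]; last first.
  by rewrite unit_combE ltnNge nj modulus0 powR0 ?gt_eqF.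
rewrite sumEFin big_mkord poweR_EFin; congr (_ `^ _)%:E.
by apply: eq_bigr => i _; rewrite unit_combE ltn_ord.
Qed.

Lemma sup_norm_comb_le n (a : nat -> K) (c : R) : 0 <= c ->
  (forall i, (i < n)%N -> modulus (a i) <= c) ->
  (sup_norm (\sum_(i < n) a i *: (unit_vec i : vec))%R <= c%:E)%E.
Proof.
move=> c0 ac; apply: ge_ereal_sup => _ [j _ <-].
by rewrite lee_fin unit_combE; case: ltnP => [/ac //|_]; rewrite modulus0.
Qed.

(** The coefficients of a signed sum over the block [q, q + M), extended by zero
    to all indices, which is the form in which domination can be applied. *)
Definition block_signs (q M : nat) (e : 'I_M -> bool) (j : nat) : K :=
  if (j < q)%N then 0 else if insub (j - q)%N is Some i then (-1) ^+ e i else 0.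

Lemma block_signsE q M (e : 'I_M -> bool) (i : 'I_M) :
  block_signs q e (q + i)%N = (-1) ^+ e i.
Proof.
rewrite /block_signs ltnNge leq_addr /= addKn.
by case: insubP => [j _ /val_inj ->|]; rewrite ?ltn_ord.
Qed.

Lemma block_signs_sum (V : nmodType) q M (e : 'I_M -> bool) (f : K -> nat -> V) :
  (forall i, f 0 i = 0) ->
  \sum_(i < q + M) f (block_signs q e i) i =
  \sum_(i < M) f ((-1) ^+ e i) (q + i)%N.
Proof.
move=> f0; rewrite big_split_ord /= big1 ?add0r => [|i _]; last first.
  by rewrite /block_signs ltn_ord f0.
by apply: eq_bigr => i _; rewrite block_signsE.
Qed.

Lemma block_signs_le1 q M (e : 'I_M -> bool) j : modulus (block_signs q e j) <= 1.
Proof.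
rewrite /block_signs; case: ifP => _; first by rewrite modulus0.
by case: insub => [i|]; rewrite ?modulus_sign ?modulus0.
Qed.

Lemma lp_dominates_signs (p : R) E (u : nat -> vec) : 0 < p ->
  dominates (lp_space k p) unit_vec E u ->
  exists2 A, 0 <= A & forall q M (e : 'I_M -> bool),
    (ss_norm E (\sum_(i < M) ((-1) ^+ e i : K) *: u (q + i)%N)%R
      <= (A * M%:R `^ p^-1)%:E)%E.
Proof.
move=> p0 [A A0 dom]; exists A; first exact: ltW.
move=> q M e; have := dom (q + M)%N (block_signs q e).
rewrite (@block_signs_sum _ q M e (fun c i => c *: u i)) => [|i]; last exact: scale0r.
move=> /le_trans; apply; rewrite /= ellp_norm_comb // EFinM lee_wpmul2l //.
  by rewrite lee_fin ltW.
rewrite (@block_signs_sum _ q M e (fun c i => modulus c `^ p)) => [|i]; last first.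
  by rewrite modulus0 powR0 ?gt_eqF.
under eq_bigr do rewrite modulus_sign powR1.
by rewrite sumr_const card_ord.
Qed.

Lemma c0_dominates_signs E (u : nat -> vec) :
  dominates (c0_space k) unit_vec E u ->
  exists2 A, 0 <= A & forall q M (e : 'I_M -> bool),
    (ss_norm E (\sum_(i < M) ((-1) ^+ e i : K) *: u (q + i)%N)%R <= A%:E)%E.
Proof.
move=> [A A0 dom]; exists A; first exact: ltW.
move=> q M e; have := dom (q + M)%N (block_signs q e).
rewrite (@block_signs_sum _ q M e (fun c i => c *: u i)) => [|i]; last exact: scale0r.
move=> /le_trans; apply; rewrite -[leRHS]mule1.
apply: lee_wpmul2l; first by rewrite lee_fin ltW.
by apply: sup_norm_comb_le => // i _; exact: block_signs_le1.
Qed.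

(** The block of length [2 ^ d] starts at the index [(2 ^ d).-1], which stands
    for the positive integer [2 ^ d]. *)
Lemma dyadic_coefficient (t : nat -> K) :
  (forall n l : nat, (0 < l)%N -> (2 ^ l.-1 <= n.+1 < 2 ^ l)%N -> t n = l%:R^-1) ->
  (forall n, t n != 0) /\
  (forall d i, (i < 2 ^ d)%N -> modulus (t ((2 ^ d).-1 + i)%N) = d.+1%:R^-1).
Proof.
move=> ht; split=> [n|d i id].
  rewrite (ht n (trunc_log 2 n.+1).+1) ?invr_neq0 ?pnatr_eq0 //=.
  exact: trunc_log_bounds.
rewrite (ht _ d.+1) ?modulusV ?modulus_nat //= -addSn prednK ?expn_gt0 //.
by rewrite leq_addr expnS mul2n -addnn ltn_add2l.
Qed.

(** Here [r = 1], [s = p^-1] for the Baernstein space, and [r = p], [s = 0] for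
    the Schreier space. *)
Theorem perturbation_not_complemented (p : R) (E D : seq_space R k) :
  (1 < p /\ (E, D) = (baernstein_space k p, lp_space k p)) \/
  (1 <= p /\ (E, D) = (schreier_space k p, c0_space k)) ->
  forall u : nat -> vec, block_basic u -> normalized E u ->
  dominates D unit_vec E u ->
  forall m : nat -> nat,
  (forall n, set_lt (supp (u n)) [set m n] /\
             set_lt [set m n] (supp (u n.+1))) ->
  forall t : nat -> K,
  (forall n l : nat, (0 < l)%N -> (2 ^ l.-1 <= n.+1 < 2 ^ l)%N -> t n = l%:R^-1) ->
  block_basic (perturbed u m t) /\
  ~ complemented E (closed_span E (range (perturbed u m t))).
Proof.
move=> ED u bu nu dom m hm t /dyadic_coefficient[t0 tE].
split; first exact: block_basic_perturbed.
case: ED => -[p1 [EE DE]]; subst E D.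
- have p0 : 0 < p by exact: lt_trans p1.
  have [A A0 upper] := lp_dominates_signs p0 dom.
  have sr : p^-1 < 1^-1 by rewrite invr1 invf_lt1.
  exact: (perturbed_not_complemented ltr01 (baernstein_schreier_solid p1)
            bu nu hm t0 A0 sr (fun d e => upper _ _ e) tE).
- have p0 : 0 < p by exact: lt_le_trans p1.
  have [A A0 upper] := c0_dominates_signs dom.
  have sr : 0 < p^-1 by rewrite invr_gt0.
  apply: (perturbed_not_complemented p0 (schreier_schreier_solid p1)
            bu nu hm t0 A0 sr _ tE).
  by move=> d e; rewrite powRr0 mulr1; exact: upper.
Qed.

End Domination.

(** * Normalised indicators of annuli *)

Section Annuli.
Context {R : realType}.

Definition annulus (n i : nat) : bool := (4 ^ n <= i.+1 < 2 * 4 ^ n)%N.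

(** The only [n] for which [i] can lie in the [n]-th annulus. *)
Definition level (i : nat) : nat := trunc_log 4 i.+1.

Definition mass (n : nat) : R := (4 ^ n)%:R^-1.

(** The density, with respect to counting, of the measure that is uniform on
    each annulus and gives it mass 1. *)
Definition density (i : nat) : R := if annulus (level i) i then mass (level i) else 0.

Lemma mass_gt0 n : 0 < mass n.
Proof. by rewrite invr_gt0 ltr0n expn_gt0. Qed.

Lemma density_ge0 i : 0 <= density i.
Proof. by rewrite /density; case: ifP => // _; exact: ltW (mass_gt0 _). Qed.

Lemma annulus_level n i : annulus n i -> level i = n.
Proof.
move=> /andP[ni iN]; apply: trunc_log_eq => //; rewrite ni /=.
by apply: (leq_trans iN); rewrite expnS leq_mul2r orbT.
Qed.

Lemma annulus_start n : annulus n (4 ^ n).-1.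
Proof. by have := expn_gt0 4 n; rewrite /annulus /=; lia. Qed.

Lemma annulusE n i : annulus n i = ((4 ^ n).-1 <= i < (4 ^ n).-1 + 4 ^ n)%N.
Proof. by have := expn_gt0 4 n; rewrite /annulus /=; lia. Qed.

(** The annuli are disjoint, so at most one term of the sum survives. *)
Lemma annulus_sumE (V : pzRingType) (g z : nat -> V) n i :
  \sum_(j < n) g j * (if annulus j i then z j else 0) =
  if (level i < n)%N && annulus (level i) i then g (level i) * z (level i) else 0.
Proof.
case: ifP => [/andP[ln li]|nli].
  rewrite (bigD1 (Ordinal ln)) //= li big1 ?addr0 // => j jl.
  case: ifP => [/annulus_level lj|]; rewrite ?mulr0 //.
  by case/eqP: jl; apply: val_inj.
rewrite big1 // => j _; case: ifP => [ji|]; rewrite ?mulr0 //.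
by move: nli; rewrite (annulus_level ji) ltn_ord ji.
Qed.

(** The annulus that contains [i] has [4 ^ n] points, and [i.+1 < 2 * 4 ^ n]. *)
Lemma density_le i : density i <= 2 / i.+1%:R.
Proof.
rewrite /density; case: ifP => [/andP[_ iN]|_]; last by rewrite divr_ge0.
rewrite /mass ler_pdivlMr // mulrC ler_pdivrMr ?ltr0n ?expn_gt0 //.
by rewrite -natrM ler_nat ltnW.
Qed.

(** A Schreier set with [c] points lies above [c], where the density is at most
    [2 / c]. *)
Lemma density_schreier (F : {fset nat}) : schreier_set F ->
  \sum_(i <- F) density i <= 2.
Proof.
move=> schF; have [->|/fset0Pn F0] := eqVneq F fset0.
  by rewrite big_seq_fset0.
have card0 : 0 < #|` F|%:R :> R.
  by rewrite ltr0n cardfs_gt0; apply/fset0Pn.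
apply: (@le_trans _ _ (\sum_(i <- F) 2 / #|` F|%:R)).
  rewrite big_seq [leRHS]big_seq; apply: ler_sum => i iF.
  apply: (le_trans (density_le i)); rewrite ler_wpM2l // lef_pV2 ?posrE //.
  by rewrite ler_nat; exact: schF.
by rewrite big_const_seq count_predT iter_addr_0 -[_ *+ _]mulr_natr divfK ?lt0r_neq0.
Qed.

Lemma sum_annulus_le n (s : seq nat) : uniq s ->
  \sum_(i <- s) (if annulus n i then mass n else 0) <= 1.
Proof.
move=> us; rewrite -big_mkcond -big_filter big_const_seq count_predT iter_addr_0.
rewrite -mulr_natl ler_pdivrMr ?ltr0n ?expn_gt0 // mul1r ler_nat.
rewrite -[leqRHS](size_iota (4 ^ n).-1); apply: uniq_leq_size.
  exact: filter_uniq.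
by move=> i; rewrite mem_filter mem_iota annulusE => /andP[].
Qed.

End Annuli.

Section Averages.
Context {R : realType} {k : scalar_kind}.
Local Notation K := (scalars R k).
Local Notation vec := (vec R k).
Context (r : R) (r0 : 0 < r) (z : nat -> K).
Context (zE : forall n, modulus (z n) = mass n `^ r^-1).

Definition average (n : nat) : vec := fun i => if annulus n i then z n else 0.

Lemma z_neq0 n : z n != 0.
Proof.
apply: contraTneq (powR_gt0 r^-1 (@mass_gt0 R n)) => zn.
by rewrite -zE zn modulus0 ltxx.
Qed.

Lemma modulus_z n : modulus (z n) `^ r = mass n.
Proof. by rewrite zE powRKV // ltW // mass_gt0. Qed.

Lemma supp_average n i : supp (average n) i <-> annulus n i.
Proof. by rewrite /supp /= /average; case: ifP => _; rewrite ?eqxx ?z_neq0. Qed.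

Lemma modulus_average n i :
  modulus (average n i) `^ r = if annulus n i then mass n else 0.
Proof.
by rewrite /average; case: ifP => _; rewrite ?modulus_z // modulus0 powR0 ?gt_eqF.
Qed.

Lemma modulus_average_comb n (a : nat -> K) i :
  modulus ((\sum_(j < n) a j *: average j) i) `^ r =
  density i * (if (level i < n)%N then modulus (a (level i)) else 0) `^ r.
Proof.
rewrite lin_combE (annulus_sumE a z) /density.
case: (annulus _ _); rewrite ?andbF ?andbT; last first.
  by rewrite mul0r modulus0 powR0 ?gt_eqF.
case: ifP => _; last by rewrite modulus0 powR0 ?gt_eqF ?mulr0.
by rewrite modulusM powRM ?modulus_ge0 // modulus_z mulrC.
Qed.

Lemma average_finite n i : ((4 ^ n).-1 + 4 ^ n <= i)%N -> average n i = 0.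
Proof. by move=> ni; rewrite /average annulusE [X in _ && X]ltnNge ni andbF. Qed.

Lemma block_basic_average : block_basic average.
Proof.
split.
- move=> n an; have /supp_average := annulus_start n.
  by rewrite an /supp /= eqxx.
- move=> n; apply: (sub_finite_set (B := `I_((4 ^ n).-1 + 4 ^ n))); last exact: finite_II.
  by move=> i /supp_average /=; rewrite annulusE => /andP[].
- move=> n i j /supp_average/andP[_ iN] /supp_average/andP[Nj _].
  by rewrite -ltnS; apply: leq_trans iN (leq_trans _ Nj); rewrite expnS leq_mul2r orbT.
Qed.

(** An annulus is a Schreier set, and it has measure 1. *)
Lemma normalized_average E : schreier_solid E r ->
  (forall n, (ss_norm E (average n) <= 1)%E) -> normalized E average.
Proof.
move=> HE le1 n; apply/eqP; rewrite eq_le le1 /=.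
have := ss_ge0 HE (average n); have := le1 n.
case N_E : (ss_norm E (average n)) => [c| |] //; rewrite !lee_fin => _ c0.
apply: (powR_le_inv r0) => //; rewrite powR1.
pose F := [fset i in iota (4 ^ n).-1 (4 ^ n)]%fset.
have FE i : (i \in F) = annulus n i by rewrite inE /= mem_iota annulusE.
have F_card : #|` F| = (4 ^ n)%N.
  by rewrite card_fseq undup_id ?iota_uniq // size_iota.
have schF : schreier_set F.
  by move=> i; rewrite FE F_card => /andP[].
apply: le_trans (ss_schreier HE (x := average n) c0 schF _); last by rewrite N_E.
under eq_bigr do rewrite modulus_average.
rewrite big_seq; under eq_bigr => i do [rewrite FE => ->].
rewrite -big_seq big_const_seq count_predT iter_addr_0 -[_ *+ _]mulr_natr F_card.
by rewrite mulVf // pnatr_eq0 -lt0n expn_gt0.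
Qed.

(** The coordinate at which [average n] is perturbed.  It lies outside all
    annuli, because the next one starts at the index [(4 ^ n.+1).-1]. *)
Definition gap (n : nat) : nat := (4 ^ n).-1 + 4 ^ n.

Lemma gap_average n : set_lt (supp (average n)) [set gap n] /\
  set_lt [set gap n] (supp (average n.+1)).
Proof.
split=> [i _ /supp_average + ->|_ j -> /supp_average]; rewrite annulusE.
  by case/andP.
by move=> /andP[nj _]; apply: leq_trans nj; have := expn_gt0 4 n; rewrite /gap expnS /=; lia.
Qed.

End Averages.

Section Existence.
Context {R : realType} {k : scalar_kind}.
Local Notation K := (scalars R k).
Local Notation vec := (vec R k).

Lemma exists_average_scalars (r : R) :
  exists z : nat -> K, forall n, modulus (z n) = mass n `^ r^-1.
Proof.
have h n : exists c : K, modulus c = mass n `^ r^-1.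
  by apply: modulus_surj; exact: powR_ge0.
by have [z zE] := choice h; exists z.
Qed.

Lemma schreier_average_le1 (p : R) (z : nat -> K) : 0 < p ->
  (forall n, modulus (z n) = mass n `^ p^-1) ->
  forall n, (schreier_norm p (average z n) <= 1)%E.
Proof.
move=> p0 zE n; apply: ge_ereal_sup => _ [F _ <-]; rewrite lee_fin.
apply: schreier_mu_le => //; rewrite powR1.
under eq_bigr do rewrite (modulus_average p0 zE).
exact/sum_annulus_le/fset_uniq.
Qed.

Lemma baernstein_average_le1 (p : R) (z : nat -> K) : 1 < p ->
  (forall n, modulus (z n) = mass n `^ 1^-1) ->
  forall n, (baernstein_norm p (average z n) <= 1)%E.
Proof.
move=> p1 zE n.
apply: (le_trans (baernstein_norm_le (ltW p1) (@average_finite _ _ z n))).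
rewrite lee_fin -(big_mkord xpredT (fun i => modulus (average z n i))).
apply: (le_trans _ (sum_annulus_le n (iota_uniq 0 ((4 ^ n).-1 + 4 ^ n)))).
rewrite /index_iota subn0; apply: ler_sum => i _.
by rewrite -(modulus_average ltr01 zE) powRr1 // modulus_ge0.
Qed.

(** The [p]-th powers of the coordinates of [\sum_j a j *: average z j] are the
    density multiplied by factors at most [sup |a j| ^ p], and a Schreier set
    has measure at most 2. *)
Lemma c0_dominates_average (p : R) (z : nat -> K) : 0 < p ->
  (forall n, modulus (z n) = mass n `^ p^-1) ->
  dominates (c0_space k) unit_vec (schreier_space k p) (average z).
Proof.
move=> p0 zE; have C0 : 0 < 2 `^ p^-1 :> R by rewrite powR_gt0.
exists (2 `^ p^-1) => // n a /=; set y := (X in sup_norm X).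
have le_y j : ((modulus (y j))%:E <= sup_norm y)%E.
  by apply: ereal_sup_ubound; exists j.
have : (0 <= sup_norm y)%E.
  by apply: le_trans (le_y 0%N); rewrite lee_fin modulus_ge0.
case N_y : (sup_norm y) => [c| |] // c0; last by rewrite gt0_muley ?lte_fin // leey.
rewrite lee_fin in c0; rewrite -EFinM.
apply: ge_ereal_sup => _ [F schF <-]; rewrite lee_fin.
have Cc0 : 0 <= 2 `^ p^-1 * c by rewrite mulr_ge0 // ltW.
apply: schreier_mu_le => //; rewrite powRM ?powR_ge0 // powRKV //.
rewrite (eq_bigr _ (fun i _ => modulus_average_comb p0 zE n a i)).
apply: (@le_trans _ _ (\sum_(i <- F) density i * c `^ p)); last first.
  by rewrite -mulr_suml ler_wpM2r ?powR_ge0 // density_schreier.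
apply: ler_sum => i _; apply: ler_wpM2l; first exact: density_ge0.
apply: powR_le; [exact: ltW|by case: ifP => // _; exact: modulus_ge0|].
case: ifP => // ln; rewrite -lee_fin -N_y.
by apply: le_trans (le_y (level i)); rewrite /y unit_combE ln.
Qed.

(** On a Schreier set [F], the power mean inequality with the density as weight
    bounds [(\sum_F |x i|) ^ p] by [2 ^ (p - 1)] times the integral over [F] of
    the [p]-th power of the coefficient.  The sets of a chain being disjoint,
    these integrals add up to at most the integral over all indices, which is
    [\sum_j |a j| ^ p] because every annulus has mass 1. *)
Lemma lp_dominates_average (p : R) (z : nat -> K) : 1 < p ->
  (forall n, modulus (z n) = mass n `^ 1^-1) ->
  dominates (lp_space k p) unit_vec (baernstein_space k p) (average z).
Proof.
move=> p1 zE; have p0 : 0 < p by exact: lt_trans p1.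
pose B : R := 2 `^ (p - 1); have B0 : 0 < B by rewrite powR_gt0.
exists (B `^ p^-1); first exact: powR_gt0.
move=> n a; rewrite /= ellp_norm_comb // -EFinM.
set A := \sum_(i < n) modulus (a i) `^ p.
have A0 : 0 <= A by apply: sumr_ge0 => i _; exact: powR_ge0.
rewrite -powRM ?(ltW B0) //.
apply: ge_ereal_sup => _ [C chainC <-]; rewrite lee_fin.
apply: baernstein_beta_le; rewrite ?powR_ge0 // powRKV ?mulr_ge0 ?(ltW B0) //.
pose b i := if (level i < n)%N then modulus (a (level i)) else 0.
have b0 i : 0 <= b i by rewrite /b; case: ifP => // _; exact: modulus_ge0.
have xE i : modulus ((\sum_(j < n) a j *: average z j) i) = density i * b i.
  have := modulus_average_comb ltr01 zE n a i.
  by rewrite !powRr1 ?modulus_ge0 //; exact: b0.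
pose g i := density i * b i `^ p : R.
have g0 i : 0 <= g i by rewrite mulr_ge0 ?density_ge0 ?powR_ge0.
have gE i : g i = \sum_(j < n) modulus (a j) `^ p * (if annulus j i then mass j else 0).
  rewrite (annulus_sumE (fun j => modulus (a j) `^ p)) /g /density /b.
  case: (annulus _ _); rewrite ?andbF ?mul0r // andbT.
  by case: ifP => _; [rewrite mulrC|rewrite powR0 ?gt_eqF ?mulr0].
have g_finite i : (4 ^ n <= i)%N -> g i = 0.
  move=> ni; rewrite /g /b ltnNge (_ : (n <= level i)%N); first by rewrite powR0 ?gt_eqF ?mulr0.
  by apply: trunc_log_max => //; exact: leqW.
apply: (@le_trans _ _ (\sum_(F <- C) B * \sum_(i <- F) g i)).
  rewrite big_seq [leRHS]big_seq; apply: ler_sum => F FC.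
  rewrite (eq_bigr _ (fun i _ => xE i)).
  apply: (le_trans (powR_wmean _ (ltW p1) density_ge0 b0)).
  rewrite ler_wpM2r //; first by apply: sumr_ge0 => i _; exact: g0.
  apply: powR_le; rewrite ?subr_ge0 ?(ltW p1) //.
    by apply: sumr_ge0 => i _; exact: density_ge0.
  by apply: density_schreier; have [_ /(_ F FC)[]] := chainC.
rewrite -mulr_sumr ler_pM2l //.
apply: (le_trans (sum_schreier_chain_le chainC g0 g_finite)).
under eq_bigr do rewrite gE.
rewrite exchange_big; apply: ler_sum => j _ /=.
rewrite -mulr_sumr -[leRHS]mulr1 ler_wpM2l ?powR_ge0 //.
rewrite -(big_mkord xpredT (fun i => if annulus j i then mass j else 0)).
by apply: sum_annulus_le; rewrite /index_iota iota_uniq.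
Qed.

Definition dyadic_inverse (n : nat) : K := (trunc_log 2 n.+1).+1%:R^-1.

Lemma dyadic_inverseE n l : (0 < l)%N -> (2 ^ l.-1 <= n.+1 < 2 ^ l)%N ->
  dyadic_inverse n = l%:R^-1.
Proof.
by case: l => // l _ nl; rewrite /dyadic_inverse (trunc_log_eq _ nl).
Qed.

Lemma baernstein_uncomplemented_block (p : R) : 1 < p ->
  exists w : nat -> vec, block_basic w /\
    ~ complemented (baernstein_space k p) (closed_span (baernstein_space k p) (range w)).
Proof.
move=> p1; have [z zE] := exists_average_scalars 1.
exists (perturbed (average z) gap dyadic_inverse).
apply: (perturbation_not_complemented (or_introl (conj p1 erefl))).
- exact: block_basic_average zE.
- apply: (normalized_average ltr01 zE (baernstein_schreier_solid p1)).
  exact: baernstein_average_le1.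
- exact: lp_dominates_average.
- exact: gap_average zE.
- exact: dyadic_inverseE.
Qed.

Lemma schreier_uncomplemented_block (p : R) : 1 <= p ->
  exists w : nat -> vec, block_basic w /\
    ~ complemented (schreier_space k p) (closed_span (schreier_space k p) (range w)).
Proof.
move=> p1; have p0 : 0 < p by exact: lt_le_trans p1.
have [z zE] := exists_average_scalars p.
exists (perturbed (average z) gap dyadic_inverse).
apply: (perturbation_not_complemented (or_intror (conj p1 erefl))).
- exact: block_basic_average zE.
- apply: (normalized_average p0 zE (schreier_schreier_solid p1)).
  exact: schreier_average_le1.
- exact: c0_dominates_average.
- exact: gap_average zE.
- exact: dyadic_inverseE.
Qed.

End Existence.

Theorem proposition5p2 (R : realType) (k : scalar_kind) (p : R) :
  (* existence of block basic sequences with uncomplemented closed span *)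
  (1 < p -> exists w : nat -> vec R k, block_basic w /\
     ~ complemented (baernstein_space k p) (closed_span (baernstein_space k p) (range w)))
  /\
  (1 <= p -> exists w : nat -> vec R k, block_basic w /\
     ~ complemented (schreier_space k p) (closed_span (schreier_space k p) (range w)))
  /\
  (* the precise form *)
  (forall (E D : seq_space R k),
     (1 < p /\ (E, D) = (baernstein_space k p, lp_space k p)) \/
     (1 <= p /\ (E, D) = (schreier_space k p, c0_space k)) ->
   forall u : nat -> vec R k,
     block_basic u ->
     skipped unit_vec u ->
     normalized E u ->
     dominates D unit_vec E u ->
   forall m : nat -> nat,
     (forall n, set_lt (supp (u n)) [set m n] /\
                set_lt [set m n] (supp (u n.+1))) ->
   forall t : nat -> scalars R k,
     (forall n l : nat, (0 < l)%N -> (2 ^ l.-1 <= n.+1 < 2 ^ l)%N ->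
        t n = l%:R^-1) ->
   let w := fun n : nat => u n + t n *: unit_vec (m n) in
   block_basic w /\ ~ complemented E (closed_span E (range w))).
Proof.
split; first exact: baernstein_uncomplemented_block.
split; first exact: schreier_uncomplemented_block.
move=> E D ED u bu _ nu dom m hm t ht w.
exact: (perturbation_not_complemented ED bu nu dom hm ht).
Qed.
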